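(* Let $\mathcal{H}_1$ and $\mathcal{H}_2$ be two real Hilbert spaces, and let $C\subset\mathcal{H}_1$ and $Q\subset\mathcal{H}_2$ be nonempty, closed and convex subsets. Let $X$ be a Banach space and let $\varphi:\mathcal{H}_1\times X\to\mathbb{R}$ and $\psi:\mathcal{H}_2\times X\to\mathbb{R}$ be two functions. Let $\mathcal{B}_1:\mathcal{H}_1\times X\to 2^{\mathcal{H}_1}$ and $\mathcal{B}_2:\mathcal{H}_2\times X\to 2^{\mathcal{H}_2}$ be two strict multivalued mappings, and let $A:\mathcal{H}_1\to\mathcal{H}_2$ be a bounded linear operator. Then the family $\mathcal{PSMVIP}$ of parametric split multivalued variational inequality problems associated with these data is LP well-posed if and only if for each $p\in X$, the solution set $S_p$ of (PSMVIP$_p$) is nonempty and $$\operatorname{diam}(S_p(\delta,\epsilon))\to 0 \text{ as } (\delta,\epsilon)\to(0,0).$$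
   Context: Data: real Hilbert spaces $\mathcal{H}_1,\mathcal{H}_2$; sets $C\subset\mathcal{H}_1$, $Q\subset\mathcal{H}_2$; a Banach space $X$; functions $\varphi:\mathcal{H}_1\times X\to\mathbb{R}$, $\psi:\mathcal{H}_2\times X\to\mathbb{R}$; multivalued mappings $\mathcal{B}_i:\mathcal{H}_i\times X\to 2^{\mathcal{H}_i}$ ($i=1,2$); a bounded linear operator $A:\mathcal{H}_1\to\mathcal{H}_2$. The product $\mathcal{H}_1\times\mathcal{H}_2$ carries its usual Hilbert space structure. A multivalued mapping is strict if all its values are nonempty. For a nonempty set $N$, $d(a,N)=\inf_{b\in N}\|a-b\|$. For $p\in X$, problem (PSMVIP$_p$) is: find $(x^*,y^* )\in\mathcal{H}_1\times\mathcal{H}_2$ for which there exists $(u^*,v^* )\in\mathcal{B}_1(x^*,p)\times\mathcal{B}_2(y^*,p)$ such that $x^*\in C$, $y^*\in Q$, $y^*=Ax^*$, $\langle u^*,x^*-x\rangle+\varphi(x^*,p)-\varphi(x,p)\le0$ for all $x\in C$, and $\langle v^*,y^*-y\rangle+\psi(y^*,p)-\psi(y,p)\le0$ for all $y\in Q$. Its solution set is $S_p$. $\mathcal{PSMVIP}$ denotes the family of problems $\{(\mathrm{PSMVIP}_p):p\in X\}$. Let $p\in X$ and $\{p_n\}\subset X$ with $p_n\to p$. A sequence $\{(x_n,y_n)\}\subset\mathcal{H}_1\times\mathcal{H}_2$ is a generalized approximating sequence for (PSMVIP$_p$) corresponding to $\{p_n\}$ if there exist $u_n\in\mathcal{B}_1(x_n,p_n)$,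 $v_n\in\mathcal{B}_2(y_n,p_n)$ and real numbers $\epsilon_n>0$ with $\epsilon_n\to0$ such that, for every $n$, $d(x_n,C)\le\epsilon_n$, $d(y_n,Q)\le\epsilon_n$, $\|y_n-Ax_n\|\le\epsilon_n$, $\langle u_n,x_n-x\rangle+\varphi(x_n,p_n)-\varphi(x,p_n)\le\epsilon_n$ for all $x\in C$, and $\langle v_n,y_n-y\rangle+\psi(y_n,p_n)-\psi(y,p_n)\le\epsilon_n$ for all $y\in Q$. $\mathcal{PSMVIP}$ is LP (Levitin-Polyak) well-posed if for each $p\in X$, $S_p$ is a singleton and for each sequence $\{p_n\}\subset X$ with $p_n\to p$, every generalized approximating sequence for (PSMVIP$_p$) corresponding to $\{p_n\}$ converges (in norm) to the unique solution. For $p\in X$ and $\delta,\epsilon>0$, $S_p(\delta,\epsilon)$ is the union, over all $q$ in the closed ball $\mathbb{B}(p,\delta)\subset X$ of center $p$ and radius $\delta$, of the sets of all $(z,w)\in\mathcal{H}_1\times\mathcal{H}_2$ such that $d(z,C)\le\epsilon$, $d(w,Q)\le\epsilon$, $\|w-Az\|\le\epsilon$, and there exist $u\in\mathcal{B}_1(z,q)$, $v\in\mathcal{B}_2(w,q)$ with $\langle u,z-x\rangle+\varphi(z,q)-\varphi(x,q)\le\epsilon$ for all $x\in C$ and $\langle v,w-y\rangle+\psi(w,q)-\psi(y,q)\le\epsilon$ for all $y\in Q$. The diameter of a set $M$ is $\operatorname{diam}(M)=\sup\{\|a-b\|:a,b\in M\}$ (possibly $+\infty$). *)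

(* Defs.v *)
From HB Require Import structures.
From mathcomp Require Import all_boot all_order all_algebra.
From mathcomp Require Import sesquilinear.
From mathcomp Require Import all_classical all_reals all_analysis.

Set Implicit Arguments.
Unset Strict Implicit.
Unset Printing Implicit Defensive.

Import Order.TTheory GRing.Theory Num.Theory.
Import numFieldNormedType.Exports.

Local Open Scope classical_set_scope.
Local Open Scope ring_scope.

(* A real Hilbert space: a Banach space whose norm comes from an inner product.
   With [idfun] as conjugation, [{dot H for idfun}] is the type of symmetric,
   positive definite bilinear forms on [H]. *)
HB.mixin Record isRealHilbert (R : realType) H
    of CompleteNormedModule R H := {
  inner : {dot H for @idfun R};
  norm_inner : forall x : H, `|x| = Num.sqrt (inner x x)
}.

#[short(type="realHilbertType")]
HB.structure Definition RealHilbert (R : realType) :=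
  {H of CompleteNormedModule R H & isRealHilbert R H}.

Definition bounded_operator (R : realType) (V W : normedModType R)
    (f : {linear V -> W}) : Prop :=
  exists M : R, forall x : V, `|f x| <= M * `|x|.

Definition set_dist (R : realType) (V : normedModType R) (a : V) (N : set V) : R :=
  inf [set `|a - b| | b in N].

Definition strict_map (H X : Type) (B : H -> X -> set H) : Prop :=
  forall x p, B x p !=set0.

Section ProductHilbert.
Context {R : realType} {H1 H2 : realHilbertType R}.

(* The norm that the library puts on [H1 * H2] is the maximum norm, so the
   Hilbert norm of the product is defined separately. *)
Definition prod_inner (z w : H1 * H2) : R := inner z.1 w.1 + inner z.2 w.2.

Definition prod_norm (z : H1 * H2) : R := Num.sqrt (prod_inner z z).

(* [diam set0] is [-oo]. *)
Definition diam (M : set (H1 * H2)) : \bar R :=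
  ereal_sup [set (prod_norm (ab.1 - ab.2))%:E | ab in M `*` M].

End ProductHilbert.

Section PSMVIP.
Context {R : realType} {H1 H2 : realHilbertType R} {X : completeNormedModType R}.
Variables (C : set H1) (Q : set H2).
Variables (phi : H1 -> X -> R) (psi : H2 -> X -> R).
Variables (B1 : H1 -> X -> set H1) (B2 : H2 -> X -> set H2).
Variable A : {linear H1 -> H2}.

Definition solution_set (p : X) : set (H1 * H2) :=
  [set z | exists u v, [/\ B1 z.1 p u, B2 z.2 p v &
    [/\ C z.1, Q z.2, z.2 = A z.1,
        forall x, C x -> inner u (z.1 - x) + phi z.1 p - phi x p <= 0 &
        forall y, Q y -> inner v (z.2 - y) + psi z.2 p - psi y p <= 0]]].

Definition approx_conditions (q : X) (eps : R) (z : H1 * H2) (u : H1) (v : H2) :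
    Prop :=
  [/\ B1 z.1 q u, B2 z.2 q v &
    [/\ set_dist z.1 C <= eps, set_dist z.2 Q <= eps, `|z.2 - A z.1| <= eps,
        forall x, C x -> inner u (z.1 - x) + phi z.1 q - phi x q <= eps &
        forall y, Q y -> inner v (z.2 - y) + psi z.2 q - psi y q <= eps]].

(* Meant to be used with [pn @ \oo --> p]; the limit [p] itself plays no
   further role. *)
Definition generalized_approximating_seq (pn : nat -> X) (zn : nat -> H1 * H2) :
    Prop :=
  exists (u : nat -> H1) (v : nat -> H2) (eps : nat -> R),
    [/\ forall n, 0 < eps n, eps n @[n --> \oo] --> 0 &
        forall n, approx_conditions (pn n) (eps n) (zn n) (u n) (v n)].

Definition LP_well_posed : Prop :=
  forall p : X, exists z : H1 * H2, solution_set p = [set z] /\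
    forall (pn : nat -> X) (zn : nat -> H1 * H2),
      pn n @[n --> \oo] --> p ->
      generalized_approximating_seq pn zn ->
      prod_norm (zn n - z) @[n --> \oo] --> 0.

Definition approx_solution_set (p : X) (delta eps : R) : set (H1 * H2) :=
  \bigcup_(q in closed_ball_ (fun x : X => `|x|) p delta)
    [set z | exists u v, approx_conditions q eps z u v].

End PSMVIP.

(* Main.v *)
Require Import Defs.
From HB Require Import structures.
From mathcomp Require Import all_boot all_order all_algebra.
From mathcomp Require Import sesquilinear.
From mathcomp Require Import all_classical all_reals all_analysis.
From mathcomp Require Import lra.

Set Implicit Arguments.
Unset Strict Implicit.
Unset Printing Implicit Defensive.

Import Order.TTheory GRing.Theory Num.Theory.
Import numFieldNormedType.Exports.

Local Open Scope classical_set_scope.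
Local Open Scope ring_scope.

(** Put S(d, e) for the approximate solution set at [p].  It grows with [d]
    and [e] and contains the solution set.  Once a solution exists, its
    diameter therefore tends to [0] exactly when, for every [r > 0], some
    S(d, d) with [d > 0] has all its pairs of points at distance at most [r]
    ([diam_cvg0P]).

    If the problem is well-posed and this criterion fails for some [r], then
    for each [n] there are two points of S(1/(n+1), 1/(n+1)) more than [r]
    apart.  They form two generalized approximating sequences
    ([approx_solution_set_seq]), which converge to the same solution, and the
    triangle inequality yields a contradiction.

    Conversely, two solutions both lie in every S(d, d) and hence coincide.
    A generalized approximating sequence for [p] eventually lies in S(d, d),
    which also contains the solution, so it converges to the solution. *)

(** * The Hilbert norm of the product and diameters *)

Section ProductNorm.
Context {R : realType} {H1 H2 : realHilbertType R}.
Implicit Types z w : H1 * H2.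

Lemma inner_norm (H : realHilbertType R) (x : H) : inner x x = `|x| ^+ 2.
Proof.
rewrite norm_inner sqr_sqrtr//.
have [->|x0] := eqVneq x 0; first by rewrite linear0l.
exact/ltW/neq0_dnorm_gt0.
Qed.

Lemma prod_normE z : prod_norm z = Num.sqrt (`|z.1| ^+ 2 + `|z.2| ^+ 2).
Proof. by rewrite /prod_norm /prod_inner !inner_norm. Qed.

Lemma prod_norm_ge0 z : 0 <= prod_norm z.
Proof. exact: sqrtr_ge0. Qed.

Lemma sqr_prod_norm z : prod_norm z ^+ 2 = `|z.1| ^+ 2 + `|z.2| ^+ 2.
Proof. by rewrite prod_normE sqr_sqrtr// addr_ge0// exprn_ge0. Qed.

Lemma prod_norm0_eq0 z : prod_norm z <= 0 -> z = 0.
Proof.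
move=> z0; have {}z0 : prod_norm z = 0 by apply/le_anti; rewrite z0 prod_norm_ge0.
have /eqP := sqr_prod_norm z; rewrite z0 expr0n eq_sym paddr_eq0 ?exprn_ge0//.
rewrite !sqrf_eq0 !normr_eq0 => /andP[/eqP z1 /eqP z2].
by case: z z1 z2 {z0} => /= a b -> ->.
Qed.

Lemma prod_normN z : prod_norm (- z) = prod_norm z.
Proof. by rewrite !prod_normE /= !normrN. Qed.

Lemma prod_norm_triangle z w : prod_norm (z + w) <= prod_norm z + prod_norm w.
Proof.
have z0 := prod_norm_ge0 z; have w0 := prod_norm_ge0 w.
have zE := sqr_prod_norm z; have wE := sqr_prod_norm w.
rewrite -(@ler_pXn2r _ 2)// ?nnegrE ?addr_ge0 ?prod_norm_ge0//.
rewrite sqr_prod_norm /= sqrrD zE wE.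
(* the Cauchy-Schwarz inequality in the plane *)
have cs : `|z.1| * `|w.1| + `|z.2| * `|w.2| <= prod_norm z * prod_norm w.
  rewrite -(@ler_pXn2r _ 2)// ?nnegrE ?addr_ge0 ?mulr_ge0//.
  rewrite exprMn zE wE.
  have := sqr_ge0 (`|z.1| * `|w.2| - `|z.2| * `|w.1|); lra.
have le1 : `|z.1 + w.1| ^+ 2 <= (`|z.1| + `|w.1|) ^+ 2.
  by rewrite ler_pXn2r ?nnegrE ?addr_ge0// ler_normD.
have le2 : `|z.2 + w.2| ^+ 2 <= (`|z.2| + `|w.2|) ^+ 2.
  by rewrite ler_pXn2r ?nnegrE ?addr_ge0// ler_normD.
rewrite !sqrrD in le1 le2; lra.
Qed.

Lemma prod_norm_triangle_sub z w t :
  prod_norm (z - w) <= prod_norm (z - t) + prod_norm (w - t).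
Proof.
rewrite -(prod_normN (w - t)).
have -> : z - w = z - t + - (w - t) by rewrite opprB addrA subrK.
exact: prod_norm_triangle.
Qed.

Lemma le_diam (M : set (H1 * H2)) z w :
  M z -> M w -> ((prod_norm (z - w))%:E <= diam M)%E.
Proof. by move=> Mz Mw; apply: ereal_sup_ubound; exists (z, w). Qed.

Lemma diam_le (M : set (H1 * H2)) (r : R) :
  (forall z w, M z -> M w -> prod_norm (z - w) <= r) -> (diam M <= r%:E)%E.
Proof.
move=> Mr; apply: ge_ereal_sup => _ [[z w] [/= Mz Mw] <-].
by rewrite lee_fin Mr.
Qed.

Lemma diam_ge0 (M : set (H1 * H2)) : M !=set0 -> (0 <= diam M)%E.
Proof.
by case=> z Mz; apply: le_trans (le_diam Mz Mz); rewrite lee_fin prod_norm_ge0.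
Qed.

(** For a monotone family, the limit over two independent parameters reduces
    to the diagonal.  Nonemptiness is needed because the empty set has diameter
    [-oo]. *)
Lemma diam_cvg0P (S : R -> R -> set (H1 * H2)) :
  (forall d e : R, 0 < d -> 0 < e -> S d e !=set0) ->
  (forall d d' e e', d <= d' -> e <= e' -> S d e `<=` S d' e') ->
  (diam (S de.1 de.2) @[de --> (0^'+, 0^'+)] --> 0%E) <->
  (forall r : R, 0 < r -> exists2 d : R, 0 < d &
     forall z w, S d d z -> S d d w -> prod_norm (z - w) <= r).
Proof.
move=> S0 Sle; split=> [Scvg r r0|Sr].
  have diag : diam (S d d) @[d --> 0^'+] --> 0%E.
    exact: (cvg_comp (fun d : R => (d, d)) _ (cvg_pair cvg_id cvg_id) Scvg).
  have near_r : \forall d \near 0^'+, (diam (S d d) < r%:E)%E.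
    have nbhs_r : nbhs 0%E [set y | (y < r%:E)%E].
      by apply: open_ereal_lt'; rewrite lte_fin.
    exact: diag _ nbhs_r.
  have [d [d0 dr]] := filter_ex (filterI (nbhs_right_gt 0) near_r).
  exists d => // z w Sz Sw.
  by rewrite -lee_fin; apply: le_trans (le_diam Sz Sw) (ltW dr).
have nearS r : 0 < r ->
    \forall de \near (0^'+ : set_system R, 0^'+ : set_system R),
      (0%:E <= diam (S de.1 de.2) <= r%:E)%E.
  move=> r0; have [d d0 Sd] := Sr r r0.
  exists (`]0, d[%classic, `]0, d[%classic).
    by split; apply: filterS (filterI (nbhs_right_gt 0) (nbhs_right_lt d0));
      move=> x [x0 xd]; rewrite /= in_itv /= x0 xd.
  move=> [a b] [/=]; rewrite !in_itv /= => /andP[a0 ad] /andP[b0 bd].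
  apply/andP; split; first exact/diam_ge0/S0.
  apply: diam_le => z w Sz Sw.
  by apply: Sd; [apply: Sle Sz|apply: Sle Sw]; exact: ltW.
have prod_filter : Filter (nbhs (0^'+ : set_system R, 0^'+ : set_system R)).
  exact: (@filter_prod_filter R R _ _ (at_right_proper_filter 0)
    (at_right_proper_filter 0)).
apply/fine_cvgP; split.
  (* any positive bound makes the diameter finite *)
  move: (nearS 1 ltr01); apply: filterS => de /andP[ge0 le1].
  rewrite fin_numE; apply/andP; split.
    by apply/eqP => E; rewrite E in ge0.
  by apply/eqP => E; rewrite E in le1.
apply/cvgrPdist_le => r r0; move: (nearS r r0); apply: filterS => de /=.
case: (diam _) => [x||] //=; rewrite ?lee_fin ?ltxx// => /andP[x0 xr].
- by rewrite sub0r normrN ger0_norm.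
- by rewrite subrr normr0 ltW.
Qed.

End ProductNorm.

(** * Approximate solutions and approximating sequences *)

Lemma set_dist_le0 (R : realType) (V : normedModType R) (a : V) (N : set V) :
  N a -> set_dist a N <= 0.
Proof.
move=> Na; apply: ge_inf; first by exists 0 => _ [b _ <-].
by exists a => //; rewrite subrr normr0.
Qed.

Section ApproximateSolutions.
Context {R : realType} {H1 H2 : realHilbertType R} {X : completeNormedModType R}.
Variables (C : set H1) (Q : set H2).
Variables (phi : H1 -> X -> R) (psi : H2 -> X -> R).
Variables (B1 : H1 -> X -> set H1) (B2 : H2 -> X -> set H2).
Variable A : {linear H1 -> H2}.

Local Notation sol := (solution_set C Q phi psi B1 B2 A).
Local Notation cond := (approx_conditions C Q phi psi B1 B2 A).
Local Notation S := (approx_solution_set C Q phi psi B1 B2 A).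
Local Notation approx_seq := (generalized_approximating_seq C Q phi psi B1 B2 A).

Lemma approx_conditions_le q eps eps' z u v :
  eps <= eps' -> cond q eps z u v -> cond q eps' z u v.
Proof.
move=> le_eps [Bu Bv [zC zQ zA zphi zpsi]]; split=> //; split.
- exact: le_trans zC le_eps.
- exact: le_trans zQ le_eps.
- exact: le_trans zA le_eps.
- by move=> x Cx; apply: le_trans (zphi x Cx) le_eps.
- by move=> y Qy; apply: le_trans (zpsi y Qy) le_eps.
Qed.

Lemma approx_solution_set_le p d d' eps eps' :
  d <= d' -> eps <= eps' -> S p d eps `<=` S p d' eps'.
Proof.
move=> le_d le_eps z [q pq [u [v zuv]]]; exists q; first exact: le_trans pq le_d.
by exists u, v; apply: approx_conditions_le zuv.
Qed.

Lemma sub_solution_approx p d eps :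
  0 <= d -> 0 <= eps -> sol p `<=` S p d eps.
Proof.
move=> d0 eps0 z [u [v [Bu Bv [zC zQ zA zphi zpsi]]]].
exists p; first by rewrite /closed_ball_ /= subrr normr0.
exists u, v; apply: (approx_conditions_le eps0); split=> //; split=> //.
- exact: set_dist_le0.
- exact: set_dist_le0.
- by rewrite zA subrr normr0.
Qed.

(** A choice of one point in each S(1/(n+1), 1/(n+1)) is a generalized
    approximating sequence. *)
Lemma approx_solution_set_seq p (zn : nat -> H1 * H2) :
  (forall n, S p n.+1%:R^-1 n.+1%:R^-1 (zn n)) ->
  exists2 pn : nat -> X, pn n @[n --> \oo] --> p & approx_seq pn zn.
Proof.
move=> Szn.
have /choice[g gP] : forall n, exists g : X * (H1 * H2),
    `|p - g.1| <= n.+1%:R^-1 /\ cond g.1 n.+1%:R^-1 (zn n) g.2.1 g.2.2.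
  by move=> n; have [q pq [u [v zuv]]] := Szn n; exists (q, (u, v)).
exists (fun n => (g n).1).
  apply/cvgrPdist_le => e e0.
  have /cvgrPdist_le/(_ e e0)[N _ NP] := @cvg_harmonic R.
  exists N => // n /NP /=; rewrite sub0r normrN gtr0_norm ?invr_gt0// => ne.
  exact: le_trans (gP n).1 ne.
exists (fun n => (g n).2.1), (fun n => (g n).2.2), (fun n => n.+1%:R^-1).
split=> [n||n]; [by rewrite invr_gt0|exact: cvg_harmonic|exact: (gP n).2].
Qed.

Lemma approx_seq_near p (pn : nat -> X) (zn : nat -> H1 * H2) d :
  pn n @[n --> \oo] --> p -> approx_seq pn zn -> 0 < d ->
  \forall n \near \oo, S p d d (zn n).
Proof.
move=> pnp [u [v [eps [eps0 epscvg znP]]]] d0.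
have pnd : \forall n \near \oo, `|p - pn n| <= d by move/cvgrPdist_le: pnp; apply.
have epsd : \forall n \near \oo, `|0 - eps n| <= d.
  by move/cvgrPdist_le: epscvg; apply.
near=> n.
have pn_d : `|p - pn n| <= d by near: n.
have eps_d : eps n <= d.
  rewrite -(gtr0_norm (eps0 n)) -normrN -(sub0r (eps n)).
  by near: n.
exists (pn n) => //; exists (u n), (v n).
exact: approx_conditions_le eps_d (znP n).
Unshelve. all: by end_near. Qed.

End ApproximateSolutions.

(** * The characterization of well-posedness *)

Theorem theorem12 (R : realType) (H1 H2 : realHilbertType R)
    (C : set H1) (Q : set H2)
    (C_nonempty : C !=set0) (C_closed : closed C) (C_convex : convex_set C)
    (Q_nonempty : Q !=set0) (Q_closed : closed Q) (Q_convex : convex_set Q)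
    (X : completeNormedModType R)
    (phi : H1 -> X -> R) (psi : H2 -> X -> R)
    (B1 : H1 -> X -> set H1) (B2 : H2 -> X -> set H2)
    (B1_strict : strict_map B1) (B2_strict : strict_map B2)
    (A : {linear H1 -> H2}) (A_bounded : bounded_operator A) :
  LP_well_posed C Q phi psi B1 B2 A <->
  forall p : X,
    solution_set C Q phi psi B1 B2 A p !=set0 /\
    (diam (approx_solution_set C Q phi psi B1 B2 A p de.1 de.2)
       @[de --> (0^'+, 0^'+)] --> 0%E).
Proof.
set S := approx_solution_set C Q phi psi B1 B2 A.
have S_small p : solution_set C Q phi psi B1 B2 A p !=set0 ->
    (diam (S p de.1 de.2) @[de --> (0^'+, 0^'+)] --> 0%E) <->
    (forall r : R, 0 < r -> exists2 d : R, 0 < d &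
       forall z w, S p d d z -> S p d d w -> prod_norm (z - w) <= r).
  move=> [z sz]; apply: (@diam_cvg0P _ _ _ (S p)) => [d e d0 e0|d d' e e'].
    by exists z; apply: sub_solution_approx sz; exact: ltW.
  exact: approx_solution_set_le.
split=> [wp p|Sdiam p].
  have [z [solE cvgz]] := wp p.
  have sol0 : solution_set C Q phi psi B1 B2 A p !=set0 by exists z; rewrite solE.
  split=> //; apply/(S_small p sol0) => r r0.
  apply: contrapT => far.
  have /choice[g gP] : forall n, exists g : (H1 * H2) * (H1 * H2),
      [/\ S p n.+1%:R^-1 n.+1%:R^-1 g.1, S p n.+1%:R^-1 n.+1%:R^-1 g.2 &
          r < prod_norm (g.1 - g.2)].
    move=> n; apply: contrapT => noz; apply: far.
    exists n.+1%:R^-1; first by rewrite invr_gt0.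
    move=> a b Sa Sb; rewrite leNgt; apply/negP => rab.
    by apply: noz; exists (a, b).
  have [pn pnp an] :
      exists2 pn : nat -> X, pn n @[n --> \oo] --> p &
        generalized_approximating_seq C Q phi psi B1 B2 A pn (fun n => (g n).1).
    by apply: approx_solution_set_seq => n; have [] := gP n.
  have [qn qnp bn] :
      exists2 qn : nat -> X, qn n @[n --> \oo] --> p &
        generalized_approximating_seq C Q phi psi B1 B2 A qn (fun n => (g n).2).
    by apply: approx_solution_set_seq => n; have [] := gP n.
  have r20 : 0 < r / 2 by rewrite divr_gt0.
  have near1 : \forall n \near \oo, `|0 - prod_norm ((g n).1 - z)| <= r / 2.
    by have /cvgrPdist_le := cvgz _ _ pnp an; apply.
  have near2 : \forall n \near \oo, `|0 - prod_norm ((g n).2 - z)| <= r / 2.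
    by have /cvgrPdist_le := cvgz _ _ qnp bn; apply.
  have [n [/= n1 n2]] := filter_ex (filterI near1 near2).
  move: n1 n2; rewrite !sub0r !normrN !ger0_norm ?prod_norm_ge0// => n1 n2.
  have [_ _ rg] := gP n.
  have := prod_norm_triangle_sub (g n).1 (g n).2 z; lra.
have [sol0 diam0] := Sdiam p.
have small := (S_small p sol0).1 diam0.
have [z sz] := sol0; exists z; split.
  apply/seteqP; split=> [w sw|w ->//].
  apply/eqP; rewrite -subr_eq0; apply/eqP/prod_norm0_eq0.
  apply/ler_addgt0Pl => r r0; rewrite addr0.
  have [d d0 Sd] := small r r0.
  by apply: Sd; [apply: sub_solution_approx sw|apply: sub_solution_approx sz];
    exact: ltW.
move=> pn zn pnp zn_approx; apply/cvgrPdist_le => r r0.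
have [d d0 Sd] := small r r0.
move: (approx_seq_near pnp zn_approx d0); apply: filterS => n Szn.
rewrite sub0r normrN ger0_norm ?prod_norm_ge0//; apply: Sd => //.
by apply: sub_solution_approx sz; exact: ltW.
Qed.
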